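(* Let $\mathcal C$ be a strict BTC over $\mathbb F$ and $\mathcal S\subset\mathcal C$ a full tensor subcategory which is symmetric, even, and finite, and all of whose simple objects are one dimensional; equivalently $\mathcal S\simeq\mathrm{Rep}\,G$ with $G$ a finite abelian group. Let $(\Gamma,m,\eta)$ be the regular monoid in $\mathcal S$. Then for every simple $X\in\mathcal C$ $$\partial_0X=d(X)^{-1}\,(\mathrm{id}_\Gamma\otimes\mathrm{Tr}_X)(c_{X,\Gamma}\circ c_{\Gamma,X})\in\mathrm{End}_{\mathcal C}(\Gamma)$$ is an element of $G=\mathrm{Aut}(\Gamma,m,\eta)$. If $\mathcal C_G$ is the full subcategory of homogeneous objects of $\mathcal C$, i.e. of objects all simple summands $X_j$ of which have the same $\partial_0X_j$, then $\mathcal C$ is a $G$-graded tensor category; to wit, $\mathcal C$ is a crossed $G$-category with trivial $G$-action.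
   Context: $\mathbb F$ is an algebraically closed field of characteristic zero. A BTC is a semisimple $\mathbb F$-linear rigid braided ribbon category with finite dimensional $\mathrm{Hom}$-spaces and $\mathrm{End}\,\mathbf 1=\mathbb F\,\mathrm{id}_{\mathbf 1}$; it carries a canonical spherical structure with traces $\mathrm{Tr}_X$ and dimensions $d(X)=\mathrm{Tr}_X(\mathrm{id}_X)$. The braiding is denoted $c$. For $s\in\mathrm{End}(\Gamma\otimes X)$, $(\mathrm{id}_\Gamma\otimes\mathrm{Tr}_X)(s)\in\mathrm{End}\,\Gamma$ denotes the partial trace over $X$. ''Symmetric, even'' means that $\mathcal S$, with the structures inherited from $\mathcal C$, is a symmetric BTC with trivial twists and positive integer dimensions, so that there is a finite group $G$ with $\mathcal S\simeq\mathrm{Rep}_{\mathbb F}G$ as symmetric tensor categories. The regular monoid $(\Gamma,m,\eta)$ in $\mathcal S$ is the commutative monoid corresponding under this equivalence to the left regular representation on functions $G\to\mathbb F$ with pointwise multiplication $m$ and unit $\eta$ the constant function $1$. $G$ is identified with $\mathrm{Aut}(\Gamma,m,\eta)=\{g\in\mathrm{End}\,\Gamma\mid g\circ m=m\circ(g\otimes g),\ g\circ\eta=\eta\}$, a group under composition. For a nonzero homogeneous object $X$, $\partial_0X\in G$ denotes the common value on its simple summands. That $\mathcal C$ is a $G$-graded tensor category (crossed $G$-category with trivial $G$-action) means: $\mathcal C_G$ is a full tensor subcategory, $\partial_0:\mathrm{Obj}\,\mathcal C_G\to G$ is constant on isomorphism classes, $\partial_0(X\otimes Y)=\partial_0X\,\partial_0Y$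 for all $X,Y\in\mathcal C_G$, and every object of $\mathcal C$ is a direct sum of objects of $\mathcal C_G$. (In general a crossed $G$-category also has an action $\gamma$ of $G$ by strict tensor automorphisms with $\partial(\gamma_g(X))=g\,\partial(X)\,g^{-1}$; here $\gamma_g=\mathrm{id}$ and $G$ is abelian.) *)

(* Defs.v *)
From HB Require Import structures.
From mathcomp Require Import all_boot all_order all_algebra all_fingroup.

Set Implicit Arguments.
Unset Strict Implicit.
Unset Printing Implicit Defensive.

Import GRing.Theory.
Local Open Scope ring_scope.

Declare Scope cat_scope.
Delimit Scope cat_scope with cat.
Local Open Scope cat_scope.

Reserved Notation "g '∘' f" (at level 40, left associativity).
Reserved Notation "X '⊗' Y" (at level 35, no associativity).
Reserved Notation "f '⊠' g" (at level 35, no associativity).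

Record lincat (F : fieldType) := LinCat {
  ob :> Type;
  mor : ob -> ob -> vectType F;
  idm : forall X, mor X X;
  mcomp : forall X Y Z, mor Y Z -> mor X Y -> mor X Z;
  comp1m : forall X Y (f : mor X Y), mcomp (idm Y) f = f;
  compm1 : forall X Y (f : mor X Y), mcomp f (idm X) = f;
  compA : forall W X Y Z (h : mor Y Z) (g : mor X Y) (f : mor W X),
    mcomp h (mcomp g f) = mcomp (mcomp h g) f;
  comp_linear_l : forall X Y Z (f : mor X Y), linear (fun g : mor Y Z => mcomp g f);
  comp_linear_r : forall X Y Z (g : mor Y Z), linear (fun f : mor X Y => mcomp g f)
}.
Arguments mor {F l} X Y.
Arguments idm {F l} X.
Arguments mcomp {F l X Y Z} g f.
Notation "g '∘' f" := (mcomp g f) : cat_scope.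

Section LinearCategories.
Context (F : fieldType) (C : lincat F).
Implicit Types X Y Z K Q : C.

(* The identity of X seen as a morphism from X to an object equal to X. *)
Definition eqm X Y (e : X = Y) : mor X Y :=
  match e in _ = Z return mor X Z with erefl => idm X end.

Definition is_iso X Y (f : mor X Y) : Prop :=
  exists g : mor Y X, g ∘ f = idm X /\ f ∘ g = idm Y.

Definition isomorphic X Y : Prop := exists f : mor X Y, is_iso f.

Definition is_zero X : Prop := idm X = 0.

Definition is_mono X Y (f : mor X Y) : Prop :=
  forall Z (g h : mor Z X), f ∘ g = f ∘ h -> g = h.

Definition is_epi X Y (f : mor X Y) : Prop :=
  forall Z (g h : mor Y Z), g ∘ f = h ∘ f -> g = h.

Definition is_kernel X Y (f : mor X Y) K (k : mor K X) : Prop :=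
  f ∘ k = 0 /\
  forall Z (h : mor Z X), f ∘ h = 0 -> exists! h' : mor Z K, k ∘ h' = h.

Definition is_cokernel X Y (f : mor X Y) Q (q : mor Y Q) : Prop :=
  q ∘ f = 0 /\
  forall Z (h : mor Y Z), h ∘ f = 0 -> exists! h' : mor Q Z, h' ∘ q = h.

(* Z is a direct sum (biproduct) of a finite family; a zero object for n = 0. *)
Definition direct_sum n (Xs : 'I_n -> C) Z : Prop :=
  exists (i : forall k, mor (Xs k) Z) (p : forall k, mor Z (Xs k)),
    [/\ forall k, p k ∘ i k = idm (Xs k),
        forall k l, k != l -> p k ∘ i l = 0
      & \sum_(k < n) i k ∘ p k = idm Z].

Definition is_summand Y X : Prop :=
  exists (i : mor Y X) (p : mor X Y), p ∘ i = idm Y.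

Definition simple_ob X : Prop :=
  ~ is_zero X /\
  forall Y (f : mor Y X), is_mono f -> is_zero Y \/ is_iso f.

Record abelian_cat : Prop := {
  abelian_dsum : forall n (Xs : 'I_n -> C), exists Z, direct_sum Xs Z;
  abelian_ker : forall X Y (f : mor X Y), exists K (k : mor K X), is_kernel f k;
  abelian_coker : forall X Y (f : mor X Y), exists Q (q : mor Y Q), is_cokernel f q;
  abelian_mono : forall X Y (f : mor X Y), is_mono f ->
    exists Z (g : mor Y Z), is_kernel g f;
  abelian_epi : forall X Y (f : mor X Y), is_epi f ->
    exists Z (g : mor Z X), is_cokernel g f
}.

Definition semisimple_cat : Prop :=
  abelian_cat /\
  forall X, exists n (Xs : 'I_n -> C), (forall k, simple_ob (Xs k)) /\ direct_sum Xs X.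

Definition finite_cat : Prop :=
  exists n (Xs : 'I_n -> C), forall X, simple_ob X -> exists k, isomorphic X (Xs k).

Definition full_subcat (P : C -> Prop) : lincat F :=
  @LinCat F {X : C | P X}
    (fun A B => mor (sval A) (sval B))
    (fun A => idm (sval A))
    (fun _ _ _ g f => g ∘ f)
    (fun _ _ f => comp1m f)
    (fun _ _ f => compm1 f)
    (fun _ _ _ _ h g f => compA h g f)
    (fun _ _ B f => @comp_linear_l F C _ _ (sval B) f)
    (fun A _ _ g => @comp_linear_r F C (sval A) _ _ g).

End LinearCategories.

(* Strictness: associativity and unitality hold as equalities of objects, and
   the identity morphisms along these equalities are natural, i.e. on morphisms
   the strict laws hold up to transport.                                      *)
Record tencat (F : fieldType) := TenCat {
  tencat_lincat :> lincat F;
  tens : tencat_lincat -> tencat_lincat -> tencat_lincat;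
  tunit : tencat_lincat;
  tensm : forall (X Y X' Y' : tencat_lincat),
    mor X Y -> mor X' Y' -> mor (tens X X') (tens Y Y');
  tensm1 : forall X X', tensm (idm X) (idm X') = idm (tens X X');
  tensm_comp : forall (X Y Z X' Y' Z' : tencat_lincat)
    (g : mor Y Z) (f : mor X Y) (g' : mor Y' Z') (f' : mor X' Y'),
    tensm (g ∘ f) (g' ∘ f') = tensm g g' ∘ tensm f f';
  tensm_linear_l : forall (X Y X' Y' : tencat_lincat) (f' : mor X' Y'),
    linear (fun f : mor X Y => tensm f f');
  tensm_linear_r : forall (X Y X' Y' : tencat_lincat) (f : mor X Y),
    linear (fun f' : mor X' Y' => tensm f f');
  tensA : forall X Y Z, tens X (tens Y Z) = tens (tens X Y) Z;
  tens1o : forall X, tens tunit X = X;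
  tenso1 : forall X, tens X tunit = X;
  tensmA : forall (X Y Z X' Y' Z' : tencat_lincat)
    (f : mor X X') (g : mor Y Y') (h : mor Z Z'),
    eqm (tensA X' Y' Z') ∘ tensm f (tensm g h)
      = tensm (tensm f g) h ∘ eqm (tensA X Y Z);
  tens1m : forall (X Y : tencat_lincat) (f : mor X Y),
    eqm (tens1o Y) ∘ tensm (idm tunit) f = f ∘ eqm (tens1o X);
  tensm_1 : forall (X Y : tencat_lincat) (f : mor X Y),
    eqm (tenso1 Y) ∘ tensm f (idm tunit) = f ∘ eqm (tenso1 X)
}.
Arguments tens {F t} X Y.
Arguments tunit {F} t.
Arguments tensm {F t X Y X' Y'} f g.
Notation "X '⊗' Y" := (tens X Y) : cat_scope.
Notation "f '⊠' g" := (tensm f g) : cat_scope.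

Section TensorCategories.
Context (F : fieldType) (C : tencat F).
Implicit Types X Y Z : C.

Definition asc X Y Z : mor (X ⊗ (Y ⊗ Z)) ((X ⊗ Y) ⊗ Z) := eqm (tensA X Y Z).
Definition asc' X Y Z : mor ((X ⊗ Y) ⊗ Z) (X ⊗ (Y ⊗ Z)) := eqm (esym (tensA X Y Z)).
Definition lun X : mor (tunit C ⊗ X) X := eqm (tens1o X).
Definition lun' X : mor X (tunit C ⊗ X) := eqm (esym (tens1o X)).
Definition run X : mor (X ⊗ tunit C) X := eqm (tenso1 X).
Definition run' X : mor X (X ⊗ tunit C) := eqm (esym (tenso1 X)).

Definition full_tensor_subcat (P : C -> Prop) : Prop :=
  P (tunit C) /\ forall X Y, P X -> P Y -> P (X ⊗ Y).

End TensorCategories.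

Record tensor_functor (F : fieldType) (C : tencat F) := TensorFunctor {
  tf_ob :> C -> C;
  tf_mor : forall X Y : C, mor X Y -> mor (tf_ob X) (tf_ob Y);
  tf_linear : forall X Y : C, linear (@tf_mor X Y);
  tf_id : forall X, tf_mor (idm X) = idm (tf_ob X);
  tf_comp : forall (X Y Z : C) (g : mor Y Z) (f : mor X Y),
    tf_mor (g ∘ f) = tf_mor g ∘ tf_mor f;
  tf_one : tf_ob (tunit C) = tunit C;
  tf_tens : forall X Y, tf_ob (X ⊗ Y) = tf_ob X ⊗ tf_ob Y;
  tf_tensm : forall (X Y X' Y' : C) (f : mor X Y) (f' : mor X' Y'),
    eqm (tf_tens Y Y') ∘ tf_mor (f ⊠ f')
      = (tf_mor f ⊠ tf_mor f') ∘ eqm (tf_tens X X')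
}.
Arguments tf_mor {F C} t {X Y} f.

Lemma eqm_refl_comp (F : fieldType) (C : lincat F) (X Y : C) (f : mor X Y) :
  eqm (erefl Y) ∘ f = f ∘ eqm (erefl X).
Proof. by rewrite comp1m compm1. Qed.

Lemma id_linear (F : fieldType) (V : lmodType F) : linear (fun v : V => v).
Proof. by []. Qed.

Definition id_tensor_functor (F : fieldType) (C : tencat F) : tensor_functor C :=
  @TensorFunctor F C
    (fun X => X) (fun X Y f => f)
    (fun X Y => @id_linear F (mor X Y))
    (fun X => erefl) (fun X Y Z g f => erefl) erefl
    (fun X Y => erefl)
    (fun X Y X' Y' f f' => eqm_refl_comp (f ⊠ f')).

Definition same_functor (F : fieldType) (C : tencat F) (Sob Tob : C -> C)
    (Smor : forall X Y : C, mor X Y -> mor (Sob X) (Sob Y))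
    (Tmor : forall X Y : C, mor X Y -> mor (Tob X) (Tob Y)) : Prop :=
  exists e : forall X, Sob X = Tob X,
  forall (X Y : C) (f : mor X Y), eqm (e Y) ∘ Smor X Y f = Tmor X Y f ∘ eqm (e X).

(* P is the full subcategory of homogeneous objects, deg the grading and gamma
   the action.  The degree is a map on all objects, of which only the values on
   nonzero objects in P are meaningful: a zero object cannot have a degree
   compatible with tensor products.                                           *)
Record crossed_category (F : fieldType) (G : groupType) (C : tencat F)
    (P : C -> Prop) (deg : C -> G) (gamma : G -> tensor_functor C) : Prop := {
  crossed_sub : full_tensor_subcat P;
  crossed_iso : forall X Y : C, P X -> P Y -> ~ is_zero X ->
    isomorphic X Y -> deg X = deg Y;
  crossed_tens : forall X Y : C, P X -> P Y -> ~ is_zero X -> ~ is_zero Y ->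
    deg (X ⊗ Y) = (deg X * deg Y)%g;
  crossed_dsum : forall X : C, exists n (Xs : 'I_n -> C),
    (forall k, P (Xs k)) /\ direct_sum Xs X;
  crossed_act_sub : forall (g : G) (X : C), P X -> P (gamma g X);
  crossed_act_deg : forall (g : G) (X : C), P X -> ~ is_zero X ->
    deg (gamma g X) = (g * deg X * g^-1)%g;
  crossed_act1 :
    same_functor (@tf_mor F C (gamma 1%g)) (@tf_mor F C (id_tensor_functor C));
  crossed_actM : forall g h : G,
    same_functor (@tf_mor F C (gamma (g * h)%g))
                 (fun X Y f => tf_mor (gamma g) (tf_mor (gamma h) f))
}.

Record btc (F : fieldType) := BTC {
  btc_tencat :> tencat F;
  btc_semisimple : semisimple_cat btc_tencat;
  btc_one_neq0 : ~ is_zero (tunit btc_tencat);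
  btc_one_scalar : forall f : mor (tunit btc_tencat) (tunit btc_tencat),
    exists a : F, f = a *: idm (tunit btc_tencat);
  braid : forall X Y : btc_tencat, mor (X ⊗ Y) (Y ⊗ X);
  braid_iso : forall X Y, is_iso (braid X Y);
  braid_nat : forall (X Y X' Y' : btc_tencat) (f : mor X X') (g : mor Y Y'),
    braid X' Y' ∘ (f ⊠ g) = (g ⊠ f) ∘ braid X Y;
  braid_hexr : forall X Y Z : btc_tencat,
    braid X (Y ⊗ Z) =
      asc Y Z X ∘ (idm Y ⊠ braid X Z) ∘ asc' Y X Z ∘ (braid X Y ⊠ idm Z) ∘ asc X Y Z;
  braid_hexl : forall X Y Z : btc_tencat,
    braid (X ⊗ Y) Z =
      asc' Z X Y ∘ (braid X Z ⊠ idm Y) ∘ asc X Z Y ∘ (idm X ⊠ braid Y Z) ∘ asc' X Y Z;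
  dual_ob : btc_tencat -> btc_tencat;
  ev : forall X, mor (dual_ob X ⊗ X) (tunit btc_tencat);
  coev : forall X, mor (tunit btc_tencat) (X ⊗ dual_ob X);
  dual_snakel : forall X,
    run X ∘ (idm X ⊠ ev X) ∘ asc' X (dual_ob X) X ∘ (coev X ⊠ idm X) ∘ lun' X = idm X;
  dual_snaker : forall X,
    lun (dual_ob X) ∘ (ev X ⊠ idm (dual_ob X)) ∘ asc (dual_ob X) X (dual_ob X)
      ∘ (idm (dual_ob X) ⊠ coev X) ∘ run' (dual_ob X) = idm (dual_ob X);
  twist : forall X : btc_tencat, mor X X;
  twist_iso : forall X, is_iso (twist X);
  twist_nat : forall (X Y : btc_tencat) (f : mor X Y), twist Y ∘ f = f ∘ twist X;
  twist_tens : forall X Y : btc_tencat,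
    twist (X ⊗ Y) = braid Y X ∘ braid X Y ∘ (twist X ⊠ twist Y);
  twist_dual : forall X : btc_tencat,
    (twist X ⊠ idm (dual_ob X)) ∘ coev X = (idm X ⊠ twist (dual_ob X)) ∘ coev X
}.
Arguments braid {F b} X Y.
Arguments dual_ob {F b} X.
Arguments ev {F b} X.
Arguments coev {F b} X.
Arguments twist {F b} X.

Section BTC.
Context (F : fieldType) (C : btc F).
Implicit Types X Y : C.

(* The unique a such that f = a *: idm 1, as End 1 = F id. *)
Definition scalar_of (f : mor (tunit C) (tunit C)) : F :=
  coord [tuple idm (tunit C)] ord0 f.

(* The right evaluation of the canonical spherical structure: the twist and the
   braiding turn the left dual of X into a right dual.                        *)
Definition evr X : mor (X ⊗ dual_ob X) (tunit C) :=
  ev X ∘ braid X (dual_ob X) ∘ (twist X ⊠ idm (dual_ob X)).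

Definition qtrace X (s : mor X X) : F :=
  scalar_of (evr X ∘ (s ⊠ idm (dual_ob X)) ∘ coev X).

Definition qdim X : F := qtrace (idm X).

Definition ptrace A X (s : mor (A ⊗ X) (A ⊗ X)) : mor A A :=
  run A ∘ (idm A ⊠ evr X) ∘ asc' A X (dual_ob X) ∘ (s ⊠ idm (dual_ob X))
    ∘ asc A X (dual_ob X) ∘ (idm A ⊠ coev X) ∘ run' A.

(* S is a full tensor subcategory which, with the inherited structures, is a
   symmetric BTC with trivial twists and positive integer dimensions.        *)
Record symmetric_even (S : C -> Prop) : Prop := {
  se_tensor : full_tensor_subcat S;
  se_semisimple : semisimple_cat (full_subcat S);
  se_dual : forall X, S X -> exists Y, S Y /\ isomorphic Y (dual_ob X);
  se_symmetric : forall X Y, S X -> S Y -> braid Y X ∘ braid X Y = idm (X ⊗ Y);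
  se_twist : forall X, S X -> twist X = idm X;
  se_dim : forall X, S X -> ~ is_zero X -> exists2 n : nat, (0 < n)%N & qdim X = n%:R
}.

Definition simples_one_dim (S : C -> Prop) : Prop :=
  forall X : full_subcat S, simple_ob X -> qdim (sval X) = 1.

End BTC.

Record group_rep (F : fieldType) (gT : finGroupType) := Rep {
  rep_space :> vectType F;
  rep_act : gT -> 'End(rep_space);
  rep_act1 : forall v, rep_act 1%g v = v;
  rep_actM : forall g h v, rep_act (g * h)%g v = rep_act g (rep_act h v)
}.
Arguments rep_act {F gT} V g : rename.

Definition equivariant (F : fieldType) (gT : finGroupType) (V W : group_rep F gT)
    (f : 'Hom(V, W)) : Prop :=
  forall g v, f (rep_act V g v) = rep_act W g (f v).

(* An F-linear symmetric tensor equivalence E from the full subcategory S to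
   Rep G; the values of E outside of S are irrelevant.  The tensor structure is
   given by bilinear maps re_mu : E X * E Y -> E (X ⊗ Y) which make E (X ⊗ Y) a
   tensor product of E X and E Y (re_univ), and by the invariant basis vector
   re_one of E 1.                                                             *)
Record rep_equivalence (F : fieldType) (C : btc F) (S : C -> Prop)
    (gT : finGroupType) := RepEquivalence {
  re_tensor : full_tensor_subcat S;
  re_ob :> C -> group_rep F gT;
  re_mor : forall X Y : C, mor X Y -> 'Hom(re_ob X, re_ob Y);
  re_mor_linear : forall X Y, S X -> S Y -> linear (@re_mor X Y);
  re_mor_id : forall X v, S X -> re_mor (idm X) v = v;
  re_mor_comp : forall (X Y Z : C) (g : mor Y Z) (f : mor X Y) v,
    S X -> S Y -> S Z -> re_mor (g ∘ f) v = re_mor g (re_mor f v);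
  re_mor_equiv : forall (X Y : C) (f : mor X Y), S X -> S Y -> equivariant (re_mor f);
  re_faithful : forall (X Y : C), S X -> S Y -> injective (@re_mor X Y);
  re_full : forall (X Y : C) (h : 'Hom(re_ob X, re_ob Y)), S X -> S Y ->
    equivariant h -> exists f : mor X Y, re_mor f = h;
  re_ess_surj : forall V : group_rep F gT, exists2 X : C, S X &
    exists2 h : 'Hom(re_ob X, V), equivariant h & bijective h;
  re_mu : forall X Y : C, re_ob X -> re_ob Y -> re_ob (X ⊗ Y);
  re_mu_linear_l : forall (X Y : C) (w : re_ob Y), S X -> S Y ->
    linear (fun v => @re_mu X Y v w);
  re_mu_linear_r : forall (X Y : C) (v : re_ob X), S X -> S Y ->
    linear (fun w => @re_mu X Y v w);
  re_univ : forall (X Y : C) (W : vectType F) (b : re_ob X -> re_ob Y -> W),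
    S X -> S Y ->
    (forall w, linear (fun v => b v w)) -> (forall v, linear (fun w => b v w)) ->
    exists! h : 'Hom(re_ob (X ⊗ Y), W), forall v w, h (re_mu v w) = b v w;
  re_mu_equiv : forall (X Y : C) g (v : re_ob X) (w : re_ob Y), S X -> S Y ->
    rep_act (re_ob (X ⊗ Y)) g (re_mu v w)
      = re_mu (rep_act (re_ob X) g v) (rep_act (re_ob Y) g w);
  re_mu_nat : forall (X Y X' Y' : C) (f : mor X X') (f' : mor Y Y') v w,
    S X -> S Y -> S X' -> S Y' ->
    re_mor (f ⊠ f') (re_mu v w) = re_mu (re_mor f v) (re_mor f' w);
  re_mu_assoc : forall (X Y Z : C) u v w, S X -> S Y -> S Z ->
    re_mor (asc X Y Z) (re_mu u (re_mu v w)) = re_mu (re_mu u v) w;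
  re_one : re_ob (tunit C);
  re_one_basis : basis_of fullv [:: re_one];
  re_one_equiv : forall g, rep_act (re_ob (tunit C)) g re_one = re_one;
  re_mu_unitl : forall (X : C) v, S X -> re_mor (lun X) (re_mu re_one v) = v;
  re_mu_unitr : forall (X : C) v, S X -> re_mor (run X) (re_mu v re_one) = v;
  re_symmetric : forall (X Y : C) v w, S X -> S Y ->
    re_mor (braid X Y) (re_mu v w) = @re_mu Y X w v
}.
Arguments re_mor {F C S gT} r {X Y} f.
Arguments re_mu {F C S gT} r {X Y} v w.
Arguments re_one {F C S gT} r.

(* (Gamma, m, eta) in S corresponds, under some symmetric tensor equivalence of
   S with Rep G for a finite group G, to the functions G -> F with the action
   (g f)(x) = f(g^-1 x), pointwise multiplication and the constant function 1. *)
Definition regular_monoid (F : fieldType) (C : btc F) (S : C -> Prop) (Gamma : C)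
    (m : mor (Gamma ⊗ Gamma) Gamma) (eta : mor (tunit C) Gamma) : Prop :=
  S Gamma /\
  exists (gT : finGroupType) (E : rep_equivalence S gT)
         (phi : 'Hom(E Gamma, {ffun gT -> F^o})),
    [/\ bijective phi,
        forall g v x, phi (rep_act (E Gamma) g v) x = phi v (g^-1 * x)%g,
        forall v w x, phi (re_mor E m (re_mu E v w)) x = phi v x * phi w x
      & forall x, phi (re_mor E eta (re_one E)) x = 1].

Definition monoid_aut (F : fieldType) (C : tencat F) (Gamma : C)
    (m : mor (Gamma ⊗ Gamma) Gamma) (eta : mor (tunit C) Gamma) :
    pred (mor Gamma Gamma) :=
  fun g => (g ∘ m == m ∘ (g ⊠ g)) && (g ∘ eta == eta).

(* Elements of monoid_aut are invertible because (Gamma, m, eta) is the regular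
   monoid (monoid_aut_inv); this is why the group carries the proof reg.        *)
Record MonAut (F : fieldType) (C : btc F) (S : C -> Prop) (Gamma : C)
    (m : mor (Gamma ⊗ Gamma) Gamma) (eta : mor (tunit C) Gamma)
    (reg : regular_monoid S m eta) := MkMonAut {
  aut_val : mor Gamma Gamma;
  _ : monoid_aut m eta aut_val
}.

Section AutGroup.
Context (F : fieldType) (C : btc F) (S : C -> Prop) (Gamma : C).
Context (m : mor (Gamma ⊗ Gamma) Gamma) (eta : mor (tunit C) Gamma).
Context (reg : regular_monoid S m eta).
Local Notation MonAut := (MonAut reg).

HB.instance Definition _ := [isSub for @aut_val F C S Gamma m eta reg].
HB.instance Definition _ := [Choice of MonAut by <:].

Lemma monoid_aut1 : monoid_aut m eta (idm Gamma).
Proof. by rewrite /monoid_aut tensm1 !comp1m compm1 !eqxx. Qed.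

Lemma monoid_autM g h :
  monoid_aut m eta g -> monoid_aut m eta h -> monoid_aut m eta (g ∘ h).
Proof.
case/andP=> /eqP gm /eqP ge /andP[/eqP hm /eqP he]; apply/andP; split; apply/eqP.
  by rewrite -compA hm compA gm -compA -tensm_comp.
by rewrite -compA he ge.
Qed.

Lemma monoid_aut_inv g : monoid_aut m eta g ->
  exists h, (h ∘ g == idm Gamma) && (g ∘ h == idm Gamma).
Proof.
case/andP=> /eqP gm /eqP ge.
case: reg => SG [gT [E [phi [phi_bij phi_act phi_m phi_1]]]].
pose Eg := re_mor E g.
have [[S1 SM] SGG] : full_tensor_subcat S /\ S (Gamma ⊗ Gamma).
  by have [S1 SM] := re_tensor E; split=> //; apply: SM.
have EgJ : equivariant Eg by exact: re_mor_equiv.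
have mulG v w : Eg (re_mor E m (re_mu E v w)) = re_mor E m (re_mu E (Eg v) (Eg w)).
  by rewrite -re_mu_nat // -!re_mor_comp // gm.
have mul0 w : re_mor E m (re_mu E 0 w) = 0.
  have := re_mu_linear_l (r := E) w SG SG (-1) 0 0.
  by rewrite scaler0 addr0 scaleN1r addNr => /= ->; rewrite linear0.
have [psi phiK psiK] := phi_bij; have phi_inj := can_inj phiK.
pose dlt (x : gT) : E Gamma := psi [ffun y => (y == x)%:R : F^o].
have phi_dlt x y : phi (dlt x) y = (y == x)%:R by rewrite psiK ffunE.
have dltJ h x : rep_act (E Gamma) h (dlt x) = dlt (h * x)%g.
  apply: (phi_inj); apply/ffunP=> y; rewrite phi_act !phi_dlt.
  by rewrite -(inj_eq (mulgI h)) mulKVg.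
have Eg0 v : Eg v = 0 -> v = 0.
  move=> Egv0; apply: (phi_inj); apply/ffunP=> x.
  rewrite linear0 ffunE; apply/eqP/idPn=> vx0.
  have dx : Eg (dlt x) = 0.
    have -> : dlt x = re_mor E m (re_mu E v ((phi v x)^-1 *: dlt x)).
      apply: (phi_inj); apply/ffunP=> y; rewrite phi_m linearZ ffunE /= !phi_dlt.
      by case: eqP => [->|_] /=; rewrite ?[_ *: _]mulr1 ?mulfV // [_ *: _]mulr0 mulr0.
    by rewrite mulG Egv0 mul0.
  have dy y : Eg (dlt y) = 0.
    by rewrite -[y](mulgKV x) -dltJ EgJ dx linear0.
  pose u := re_mor E eta (re_one E).
  have u_sum : u = \sum_y dlt y.
    apply: (phi_inj); apply/ffunP=> y; rewrite phi_1 linear_sum sum_ffunE.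
    rewrite (bigD1 y) //= phi_dlt eqxx big1 ?addr0 // => z zy.
    by rewrite phi_dlt eq_sym (negPf zy).
  have : u = 0.
    by rewrite /u -ge re_mor_comp // -/u -/Eg u_sum linear_sum big1 // => y _; apply: dy.
  move/(congr1 phi)/ffunP/(_ 1%g); rewrite phi_1 linear0 ffunE.
  by move/eqP; rewrite oner_eq0.
have Eg_inj : lker Eg == 0%VS.
  by apply/lker0P=> v w /eqP; rewrite -subr_eq0 -linearB => /eqP /Eg0 /subr0_eq.
have [h Eh] : exists h : mor Gamma Gamma, re_mor E h = (Eg^-1)%VF.
  apply: re_full => // k v; have /lker0P Egi := Eg_inj.
  have Egv w : Eg ((Eg^-1)%VF w) = w by exact: lker0_lfunVK.
  by apply: Egi; rewrite EgJ !Egv.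
exists h; apply/andP; split; apply/eqP; apply: (re_faithful (r := E) SG SG);
  apply/lfunP=> v; rewrite re_mor_comp // re_mor_id // Eh.
  exact: lker0_lfunK.
exact: lker0_lfunVK.
Qed.

Definition aut_one : MonAut := MkMonAut reg monoid_aut1.

Definition aut_mul (g h : MonAut) : MonAut :=
  MkMonAut reg (monoid_autM (valP g) (valP h)).

Definition aut_inv_val (g : MonAut) : mor Gamma Gamma :=
  xchoose (monoid_aut_inv (valP g)).

Lemma aut_inv_valK (g : MonAut) : aut_inv_val g ∘ val g = idm Gamma.
Proof. by have /andP[/eqP] := xchooseP (monoid_aut_inv (valP g)). Qed.

Lemma aut_inv_valVK (g : MonAut) : val g ∘ aut_inv_val g = idm Gamma.
Proof. by have /andP[_ /eqP] := xchooseP (monoid_aut_inv (valP g)). Qed.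

Lemma aut_inv_subproof (g : MonAut) : monoid_aut m eta (aut_inv_val g).
Proof.
have /andP[/eqP gm /eqP ge] := valP g; apply/andP; split; apply/eqP.
  rewrite -[m in LHS]compm1 -tensm1 -(aut_inv_valVK g) tensm_comp (compA m) -gm.
  by rewrite !compA aut_inv_valK comp1m.
by rewrite -[in LHS]ge compA aut_inv_valK comp1m.
Qed.

Definition aut_inv (g : MonAut) : MonAut := MkMonAut reg (aut_inv_subproof g).

Lemma aut_mulA : associative aut_mul.
Proof. by move=> f g h; apply: val_inj; apply: compA. Qed.

Lemma aut_mul1 : left_id aut_one aut_mul.
Proof. by move=> g; apply: val_inj; apply: comp1m. Qed.

Lemma aut_mul_1 : right_id aut_one aut_mul.
Proof. by move=> g; apply: val_inj; apply: compm1. Qed.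

Lemma aut_mul_V : right_inverse aut_one aut_inv aut_mul.
Proof. by move=> g; apply: val_inj; apply: aut_inv_valVK. Qed.

Lemma aut_mulV : left_inverse aut_one aut_inv aut_mul.
Proof. by move=> g; apply: val_inj; apply: aut_inv_valK. Qed.

HB.instance Definition _ := isGroup.Build MonAut
  aut_mulA aut_mul1 aut_mul_1 aut_mulV aut_mul_V.


End AutGroup.

Section Degree.
Context (F : fieldType) (C : btc F) (Gamma : C).

Definition del0 (X : C) : mor Gamma Gamma :=
  (qdim X)^-1 *: ptrace (braid X Gamma ∘ braid Gamma X).

Definition homogeneous (X : C) : Prop :=
  forall Y Z : C, simple_ob Y -> is_summand Y X -> simple_ob Z -> is_summand Z X ->
    del0 Y = del0 Z.

End Degree.

(* Main.v *)
From HB Require Import structures.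
From mathcomp Require Import all_boot all_order all_algebra all_fingroup.
From mathcomp Require boolp.
Require Import Defs.

Set Implicit Arguments.
Unset Strict Implicit.
Unset Printing Implicit Defensive.

Import GRing.Theory VectorInternalTheory.
Local Open Scope ring_scope.
Local Open Scope cat_scope.

(* Write M(A, X) for the monodromy c_{X,A} c_{A,X}. A one dimensional simple
   object Z of S is invertible, so that End (Z ⊗ X) = F for X simple and M(Z, X)
   is a scalar. Decomposing Gamma into such objects gives M(Gamma, X) = g ⊠ id
   for some g in End Gamma, and closing the X-strand identifies g with del0 X
   because d(X) <> 0. The hexagon identities turn M(Gamma, X) = g ⊠ id into
   multiplicativity, in Gamma (g is a monoid automorphism) and in X (the degree
   of a tensor product is the product of the degrees). The equivalence with
   Rep G serves to see that qdim is the vector space dimension on S, whence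
   invertibility, and that Gamma is multiplicity free, so that End Gamma is
   commutative and the trivial action is compatible with the grading. *)

(** * Linear maps and eigenvectors *)

Section LinearMaps.
Context (F : fieldType) (V W : lmodType F) (h : V -> W).
Hypothesis hL : linear h.

Let hl : {linear V -> W} := HB.pack h (GRing.isLinear.Build F V W _ h hL).

Lemma lin0 : h 0 = 0. Proof. exact: (linear0 hl). Qed.
Lemma linZ a v : h (a *: v) = a *: h v. Proof. by rewrite -[h]/(hl : V -> W) linearZ. Qed.
Lemma linB v w : h (v - w) = h v - h w. Proof. exact: (linearB hl). Qed.
Lemma lin_sum I (r : seq I) (P : pred I) (E : I -> V) :
  h (\sum_(i <- r | P i) E i) = \sum_(i <- r | P i) h (E i).
Proof. exact: (linear_sum hl). Qed.
End LinearMaps.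

Lemma linear_eigenvector (F : closedFieldType) (V : vectType F) (h : V -> V) (v0 : V) :
  linear h -> v0 != 0 -> exists (a : F) (v : V), v != 0 /\ h v = a *: v.
Proof.
move=> hL v0N; pose n := dim V; pose A : 'M[F]_n := \matrix_i v2r (h (@r2v _ V 'e_i)).
have AE (u : 'rV[F]_n) : u *m A = v2r (h (@r2v _ V u)).
  rewrite [in RHS](row_sum_delta u) linear_sum (lin_sum hL) linear_sum mulmx_sum_row.
  by apply: eq_bigr => i _; rewrite rowK linearZ (linZ hL) linearZ.
(* The nonzero vector [v0] makes the dimension positive, so the characteristic polynomial is not
   constant and has a root. *)
have n0 : (0 < n)%N.
  rewrite lt0n; apply: contraNneq v0N => n0; apply/eqP/v2r_inj; rewrite linear0.
  by apply/rowP=> -[i lt_in]; exfalso; rewrite -/n n0 in lt_in.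
have /closed_rootP[a] : size (char_poly A) != 1%N.
  by rewrite size_char_poly eqSS -lt0n.
rewrite -eigenvalue_root_char => /eigenvalueP[u uA uN]; exists a, (@r2v _ V u).
split; first by apply: contraNneq uN => u0; apply/eqP/(r2v_inj (vT := V)); rewrite u0 linear0.
by apply: v2r_inj; rewrite -AE uA linearZ /= r2vK.
Qed.

(** * Linear categories and Schur's lemma *)

Section LinearCategory.
Context (F : fieldType) (C : lincat F).
Implicit Types X Y Z W : C.

Lemma comp0m X Y Z (f : mor X Y) : (0 : mor Y Z) ∘ f = 0.
Proof. exact: (lin0 (comp_linear_l f)). Qed.
Lemma compm0 X Y Z (g : mor Y Z) : g ∘ (0 : mor X Y) = 0.
Proof. exact: (lin0 (comp_linear_r g)). Qed.
Lemma compZm X Y Z a (g : mor Y Z) (f : mor X Y) : (a *: g) ∘ f = a *: (g ∘ f).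
Proof. exact: (linZ (comp_linear_l f)). Qed.
Lemma compmZ X Y Z a (g : mor Y Z) (f : mor X Y) : g ∘ (a *: f) = a *: (g ∘ f).
Proof. exact: (linZ (comp_linear_r g)). Qed.
Lemma compmB X Y Z (g : mor Y Z) (f f' : mor X Y) : g ∘ (f - f') = g ∘ f - g ∘ f'.
Proof. exact: (linB (comp_linear_r g)). Qed.
Lemma compBm X Y Z (g g' : mor Y Z) (f : mor X Y) : (g - g') ∘ f = g ∘ f - g' ∘ f.
Proof. exact: (linB (comp_linear_l f)). Qed.
Lemma comp_suml X Y Z I (r : seq I) (P : pred I) (E : I -> mor Y Z) (f : mor X Y) :
  (\sum_(i <- r | P i) E i) ∘ f = \sum_(i <- r | P i) (E i ∘ f).
Proof. exact: (lin_sum (comp_linear_l f)). Qed.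
Lemma comp_sumr X Y Z I (r : seq I) (P : pred I) (E : I -> mor X Y) (g : mor Y Z) :
  g ∘ (\sum_(i <- r | P i) E i) = \sum_(i <- r | P i) (g ∘ E i).
Proof. exact: (lin_sum (comp_linear_r g)). Qed.

(* Rewrites a composable pair at the end of a left-nested composite. *)
Lemma compAE X Y Z (g : mor Y Z) (f : mor X Y) (h : mor X Z) :
  g ∘ f = h -> forall W (k : mor Z W), k ∘ g ∘ f = k ∘ h.
Proof. by move=> <- W k; rewrite compA. Qed.

Lemma compAE2 X Y Y' Z (g : mor Y Z) (f : mor X Y) (g' : mor Y' Z) (f' : mor X Y') :
  g ∘ f = g' ∘ f' -> forall W (k : mor Z W), k ∘ g ∘ f = k ∘ g' ∘ f'.
Proof. by move=> e W k; rewrite -compA e compA. Qed.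

Lemma eqm_comp X Y Z (e : X = Y) (e' : Y = Z) : eqm e' ∘ eqm e = eqm (etrans e e').
Proof. by case: Z / e'; rewrite comp1m. Qed.

(** Proof irrelevance is the source of all coherence here: two transports between the same objects
    agree, so unit, triangle and pentagon laws reduce to composing equalities of objects. *)
Lemma eqm_irr X Y (e e' : X = Y) : eqm e = eqm e'.
Proof. by rewrite (boolp.Prop_irrelevance e e'). Qed.

Lemma eqm_id X (e : X = X) : eqm e = idm X.
Proof. exact: (eqm_irr e erefl). Qed.

Lemma eqmK X Y (e : X = Y) (e' : Y = X) : eqm e' ∘ eqm e = idm X.
Proof. by rewrite eqm_comp eqm_id. Qed.

Lemma is_zero_summand X Y : is_zero X -> is_summand Y X -> is_zero Y.
Proof.
by move=> X0 [i [p pi]]; rewrite /is_zero -pi -[p]compm1 X0 compm0 comp0m.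
Qed.

Lemma is_summand_trans X Y Z : is_summand X Y -> is_summand Y Z -> is_summand X Z.
Proof.
move=> [i [p pi]] [j [q qj]]; exists (j ∘ i), (p ∘ q).
by rewrite compA (compAE qj) compm1.
Qed.

Lemma isomorphic_summand X Y : isomorphic X Y -> is_summand X Y.
Proof. by move=> [f [g [gf _]]]; exists f, g. Qed.

Lemma direct_sum_summand n (Xs : 'I_n -> C) X k : direct_sum Xs X -> is_summand (Xs k) X.
Proof. by move=> [i [p [pi _ _]]]; exists (i k), (p k). Qed.

Hypothesis Cab : abelian_cat C.

(** The kernel of [f] is a subobject of the simple object [X]; were it all of [X], then [f] would
    vanish, so it is zero. *)
Lemma simple_mono X Y (f : mor X Y) : simple_ob X -> f <> 0 -> is_mono f.
Proof.
move=> [_ Xsimple] fn0; have [K [k [fk0 kuniv]]] := abelian_ker Cab f.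
have kmono : is_mono k.
  move=> Z g h kgh; have [|u [_ uU]] := kuniv Z (k ∘ g).
    by rewrite compA fk0 comp0m.
  by rewrite -(uU g) // -(uU h).
have [K0|[k' [_ kk']]] := Xsimple K k kmono; last first.
  by case: fn0; rewrite -[f]compm1 -kk' compA fk0 comp0m.
move=> Z g h fgh; apply/eqP; rewrite -subr_eq0; apply/eqP.
have [|u [<- _]] := kuniv Z (g - h); first by rewrite compmB fgh subrr.
by rewrite -[k]compm1 K0 compm0 comp0m.
Qed.

Lemma schur_iso X Y (f : mor X Y) : simple_ob X -> simple_ob Y -> f <> 0 -> is_iso f.
Proof.
move=> Xs [_ Ys] fn0; have [X0|//] := Ys X f (simple_mono Xs fn0).
by case: Xs => /(_ X0).
Qed.

End LinearCategory.

(** Composition with [f] is a linear map on the nonzero space End X and has an eigenvector [v]. Then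
    [f - a] kills [v], so it is not mono and must vanish. *)
Lemma simple_scalar (F : closedFieldType) (C : lincat F) (Cab : abelian_cat C) (X : C)
    (f : mor X X) :
  simple_ob X -> exists a, f = a *: idm X.
Proof.
move=> Xs; have idn0 : idm X != 0 by apply/eqP; case: Xs.
have [a [v [vn0 fv]]] := linear_eigenvector (comp_linear_r f) idn0.
exists a; apply/eqP; rewrite -subr_eq0; apply: contraNT vn0 => /eqP fan0.
have := simple_mono Cab Xs fan0 => /(_ X v 0) ->; rewrite ?eqxx //.
by rewrite compBm fv compZm comp1m subrr compm0.
Qed.

(** * Semisimple categories *)

Section Semisimple.
Context (F : fieldType) (C : lincat F) (Css : semisimple_cat C).
Implicit Types X Y Z : C.

Lemma nonzero_simple_summand X : ~ is_zero X -> exists2 Y, simple_ob Y & is_summand Y X.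
Proof.
case: Css => _ /(_ X)[[|n] [Xs [Xss dX]]] Xn0; last first.
  by exists (Xs ord0) => //; apply: direct_sum_summand dX.
by case: dX => i [p [_ _]]; rewrite big_ord0 => /esym.
Qed.

(** Decomposing source and target writes [f] as the sum of its matrix entries between simple
    objects; one of them is nonzero. *)
Lemma nonzero_simple_component X Y (f : mor X Y) :
  f <> 0 -> exists U V (i : mor U X) (p : mor Y V),
    [/\ simple_ob U, simple_ob V & p ∘ f ∘ i <> 0].
Proof.
case: Css => _ ss fn0.
have [n [Us [Uss [i [p [_ _ ip]]]]]] := ss X.
have [l [Vs [Vss [j [q [_ _ jq]]]]]] := ss Y.
have [|no] := boolp.EM (exists a b, q b ∘ f ∘ i a <> 0).
  by move=> [a [b ?]]; exists (Us a), (Vs b), (i a), (q b).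
case: fn0; rewrite -[f]compm1 -ip -[f]comp1m -jq comp_sumr big1 // => a _.
rewrite compA !comp_suml big1 // => b _.
have [e|ne] := boolp.EM (q b ∘ f ∘ i a = 0); last by case: no; exists a, b.
by rewrite -!compA (compA f) (compA (q b)) (compA (q b)) e comp0m compm0.
Qed.

End Semisimple.

(** * Calculus in strict tensor categories *)

Section Tensor.
Context (F : fieldType) (C : tencat F).
Implicit Types X Y Z : C.

Lemma tens0m X Y X' Y' (f' : mor X' Y') : (0 : mor X Y) ⊠ f' = 0.
Proof. exact: (lin0 (tensm_linear_l f')). Qed.
Lemma tensZm X Y X' Y' a (f : mor X Y) (f' : mor X' Y') : (a *: f) ⊠ f' = a *: (f ⊠ f').
Proof. exact: (linZ (tensm_linear_l f')). Qed.
Lemma tensmZ X Y X' Y' a (f : mor X Y) (f' : mor X' Y') : f ⊠ (a *: f') = a *: (f ⊠ f').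
Proof. exact: (linZ (tensm_linear_r f)). Qed.
Lemma tens_suml X Y X' Y' I (r : seq I) (P : pred I) (E : I -> mor X Y) (f' : mor X' Y') :
  (\sum_(i <- r | P i) E i) ⊠ f' = \sum_(i <- r | P i) (E i ⊠ f').
Proof. exact: (lin_sum (tensm_linear_l f')). Qed.
Lemma tens_sumr X Y X' Y' I (r : seq I) (P : pred I) (E : I -> mor X' Y') (f : mor X Y) :
  f ⊠ (\sum_(i <- r | P i) E i) = \sum_(i <- r | P i) (f ⊠ E i).
Proof. exact: (lin_sum (tensm_linear_r f)). Qed.

Lemma ascK X Y Z : asc' X Y Z ∘ asc X Y Z = idm _. Proof. exact: eqmK. Qed.
Lemma ascVK X Y Z : asc X Y Z ∘ asc' X Y Z = idm _. Proof. exact: eqmK. Qed.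
Lemma lunK X : lun' X ∘ lun X = idm _. Proof. exact: eqmK. Qed.
Lemma lunVK X : lun X ∘ lun' X = idm _. Proof. exact: eqmK. Qed.
Lemma runK X : run' X ∘ run X = idm _. Proof. exact: eqmK. Qed.
Lemma runVK X : run X ∘ run' X = idm _. Proof. exact: eqmK. Qed.

Lemma asc_nat X Y Z X' Y' Z' (f : mor X X') (g : mor Y Y') (h : mor Z Z') :
  asc X' Y' Z' ∘ (f ⊠ (g ⊠ h)) = ((f ⊠ g) ⊠ h) ∘ asc X Y Z.
Proof. exact: tensmA. Qed.

Lemma asc'_nat X Y Z X' Y' Z' (f : mor X X') (g : mor Y Y') (h : mor Z Z') :
  asc' X' Y' Z' ∘ ((f ⊠ g) ⊠ h) = (f ⊠ (g ⊠ h)) ∘ asc' X Y Z.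
Proof.
by rewrite -[LHS]compm1 -ascVK compA -(compA _ _ (asc X Y Z)) -asc_nat compA ascK comp1m.
Qed.

Lemma lun_nat X Y (f : mor X Y) : lun Y ∘ (idm (tunit C) ⊠ f) = f ∘ lun X.
Proof. exact: tens1m. Qed.

Lemma run_nat X Y (f : mor X Y) : run Y ∘ (f ⊠ idm (tunit C)) = f ∘ run X.
Proof. exact: tensm_1. Qed.

Lemma run'_nat X Y (f : mor X Y) : run' Y ∘ f = (f ⊠ idm (tunit C)) ∘ run' X.
Proof.
by rewrite -[f in LHS]compm1 -runVK (compA f) -run_nat !compA runK comp1m.
Qed.

Lemma tensm_idr X Y Y' Y'' (g : mor Y' Y'') (f : mor Y Y') :
  (idm X ⊠ g) ∘ (idm X ⊠ f) = idm X ⊠ (g ∘ f).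
Proof. by rewrite -tensm_comp comp1m. Qed.

Lemma tensm_idl X Y Y' Y'' (g : mor Y' Y'') (f : mor Y Y') :
  (g ⊠ idm X) ∘ (f ⊠ idm X) = (g ∘ f) ⊠ idm X.
Proof. by rewrite -tensm_comp comp1m. Qed.

Lemma tensm_swap X Y X' Y' (f : mor X Y) (f' : mor X' Y') :
  (f ⊠ idm Y') ∘ (idm X ⊠ f') = (idm Y ⊠ f') ∘ (f ⊠ idm X').
Proof. by rewrite -!tensm_comp !comp1m !compm1. Qed.

Lemma eqm_tens1 X Y Z (e : X = Y) (e' : X ⊗ Z = Y ⊗ Z) : eqm e ⊠ idm Z = eqm e'.
Proof. by case: Y / e e' => e'; rewrite tensm1 eqm_id. Qed.

Lemma tens1_eqm X Y Z (e : X = Y) (e' : Z ⊗ X = Z ⊗ Y) : idm Z ⊠ eqm e = eqm e'.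
Proof. by case: Y / e e' => e'; rewrite tensm1 eqm_id. Qed.

Lemma idm_run X Y : idm X ⊠ run Y = run (X ⊗ Y) ∘ asc X Y (tunit C).
Proof.
rewrite /run /asc eqm_comp (tens1_eqm _ (congr1 (tens X) (tenso1 Y))).
exact: eqm_irr.
Qed.

Lemma lun_tens X Y : lun (X ⊗ Y) = (lun X ⊠ idm Y) ∘ asc (tunit C) X Y.
Proof.
rewrite /lun /asc (eqm_tens1 _ (congr1 (fun A => A ⊗ Y) (tens1o X))) eqm_comp.
exact: eqm_irr.
Qed.

Lemma triangle X Y : asc X (tunit C) Y ∘ (idm X ⊠ lun' Y) = run' X ⊠ idm Y.
Proof.
rewrite /lun' /run' /asc (tens1_eqm _ (congr1 (tens X) (esym (tens1o Y)))) eqm_comp.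
by rewrite (eqm_tens1 _ (congr1 (fun A => A ⊗ Y) (esym (tenso1 X)))); apply: eqm_irr.
Qed.

Lemma pentagon W X Y Z :
  asc (W ⊗ X) Y Z ∘ asc W X (Y ⊗ Z) ∘ (idm W ⊠ asc' X Y Z)
    = (asc W X Y ⊠ idm Z) ∘ asc W (X ⊗ Y) Z.
Proof.
rewrite /asc /asc' (tens1_eqm _ (congr1 (tens W) (esym (tensA X Y Z)))) !eqm_comp.
rewrite (eqm_tens1 _ (congr1 (fun A => A ⊗ Z) (tensA W X Y))) eqm_comp.
exact: eqm_irr.
Qed.

Lemma run_tunit : run (tunit C) = lun (tunit C). Proof. exact: eqm_irr. Qed.

Lemma isomorphic_trans X Y Z : isomorphic X Y -> isomorphic Y Z -> isomorphic X Z.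
Proof.
move=> [f [f' [f'f ff']]] [g [g' [g'g gg']]]; exists (g ∘ f), (f' ∘ g').
by rewrite !compA (compAE g'g) (compAE ff') !compm1.
Qed.

Lemma isomorphic_sym X Y : isomorphic X Y -> isomorphic Y X.
Proof. by move=> [f [f' [f'f ff']]]; exists f', f. Qed.

Lemma isomorphic_tensl X Y Z : isomorphic X Y -> isomorphic (X ⊗ Z) (Y ⊗ Z).
Proof.
move=> [f [f' [f'f ff']]]; exists (f ⊠ idm Z), (f' ⊠ idm Z).
by rewrite !tensm_idl f'f ff' !tensm1.
Qed.

Lemma isomorphic_scalar X Y :
  isomorphic X Y -> (forall h : mor X X, exists a, h = a *: idm X) ->
  forall f : mor Y Y, exists a, f = a *: idm Y.
Proof.
move=> [i [j [ji ij]]] Xsc f; have [a ea] := Xsc (j ∘ f ∘ i); exists a.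
have := congr1 (fun h => i ∘ h ∘ j) ea; rewrite compmZ compZm compm1 ij !compA ij comp1m.
by rewrite (compAE ij) compm1.
Qed.

End Tensor.

(** * Monodromy, degrees and nonvanishing dimensions *)

Section Braided.
Context (F : closedFieldType) (C : btc F).
Implicit Types A B X Y Z : C.

Let Css : semisimple_cat C := btc_semisimple C.
Let Cab : abelian_cat C := proj1 Css.

Definition monodromy A X : mor (A ⊗ X) (A ⊗ X) := braid X A ∘ braid A X.

Lemma monodromy_nat A X A' X' (f : mor A A') (g : mor X X') :
  monodromy A' X' ∘ (f ⊠ g) = (f ⊠ g) ∘ monodromy A X.
Proof. by rewrite /monodromy -compA braid_nat compA braid_nat -compA. Qed.

(* [f] is the degree of [X] with respect to [A]; for [A = Gamma] and [X] simple
   this forces [f = del0 Gamma X]. *)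
Definition has_degree A X (f : mor A A) : Prop := monodromy A X = f ⊠ idm X.

(** After both hexagons the monodromy of [A] with [X] stands in the middle. It acts on the
    [A]-strand only, so it slides out and leaves the monodromy of [B] with [X]. *)
Lemma has_degree_tensl A B X f g :
  has_degree X f -> has_degree X g -> @has_degree (A ⊗ B) X (f ⊠ g).
Proof.
rewrite /has_degree => fX gX; rewrite /monodromy braid_hexr braid_hexl !compA.
rewrite (compAE (ascVK X A B)) compm1.
rewrite (compAE (tensm_idl B (braid X A) (braid A X))) -/(monodromy A X) fX.
rewrite (compAE2 (asc'_nat _ _ _)) (compAE (ascK A X B)) compm1 tensm1.
rewrite (compAE (tensm_swap _ _)) compA (compAE (tensm_idr _ _ _)) -/(monodromy B X) gX.
by rewrite (compAE (esym (tensm_comp _ _ _ _))) comp1m compm1 asc_nat -compA ascVK compm1.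
Qed.

(** Here the monodromy with [Y] is innermost. Its value [g] lives on the [A]-strand and slides
    through the braiding with [X] to the source end, whence the order [f ∘ g]. *)
Lemma has_degree_tensr A X Y f g :
  @has_degree A X f -> @has_degree A Y g -> has_degree (X ⊗ Y) (f ∘ g).
Proof.
rewrite /has_degree => fX gY; rewrite /monodromy braid_hexl braid_hexr !compA.
rewrite (compAE (ascK X Y A)) compm1.
rewrite (compAE (tensm_idr X (braid Y A) (braid A Y))) -/(monodromy A Y) gY.
rewrite (compAE (asc_nat _ _ _)) !compA (compAE (ascVK X A Y)) compm1.
rewrite (compAE (tensm_idl Y _ _)) -braid_nat.
rewrite (compAE (tensm_idl Y _ _)) compA -/(monodromy A X) fX tensm_idl.
by rewrite asc'_nat tensm1 -compA ascK compm1.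
Qed.

Lemma has_degree_summand A X Y f : is_summand Y X -> has_degree X f -> @has_degree A Y f.
Proof.
move=> [i [p pi]]; rewrite /has_degree => fX.
have pi1 : (idm A ⊠ p) ∘ (idm A ⊠ i) = idm _ by rewrite tensm_idr pi tensm1.
by rewrite -[LHS]comp1m -pi1 -compA -monodromy_nat fX tensm_swap compA pi1 comp1m.
Qed.

Lemma has_degree_dsum A X f n (Xs : 'I_n -> C) :
  (forall k, has_degree (Xs k) f) -> direct_sum Xs X -> @has_degree A X f.
Proof.
move=> fXs [i [p [_ _ ip]]]; rewrite /has_degree -[LHS]compm1 -[RHS]compm1 -tensm1 -ip.
rewrite tens_sumr !comp_sumr; apply: eq_bigr => k _.
by rewrite ip -tensm_idr !compA monodromy_nat fXs -tensm_swap.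
Qed.

(** A one-sided inverse suffices, as the braiding turns it into a two-sided one. *)
Definition invertible Z : Prop := exists Z', isomorphic (Z ⊗ Z') (tunit C).

(** Tensoring with [Z'] moves [f] to an endomorphism of an object isomorphic to [X], hence to a
    scalar; tensoring with [Z] and contracting [Z ⊗ Z'] to the unit recovers [f]. *)
Lemma invertible_tens_scalar Z X (f : mor (Z ⊗ X) (Z ⊗ X)) :
  (forall h : mor X X, exists a, h = a *: idm X) ->
  invertible Z -> exists a, f = a *: idm _.
Proof.
move=> Xsc [Z' [j [j' [j'j jj']]]].
have Z'ZX : isomorphic X (Z' ⊗ (Z ⊗ X)).
  have i1 : isomorphic X (tunit C ⊗ X) by exists (lun' X), (lun X); rewrite lunK lunVK.
  apply: isomorphic_trans i1 _.
  have i2 : isomorphic ((Z' ⊗ Z) ⊗ X) (Z' ⊗ (Z ⊗ X)).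
    by exists (asc' Z' Z X), (asc Z' Z X); rewrite ascK ascVK.
  apply: (isomorphic_trans _ i2); apply: isomorphic_sym; apply: isomorphic_tensl.
  apply: (isomorphic_trans (Y := Z ⊗ Z')); last by exists j, j'.
  by exists (braid Z' Z); apply: braid_iso.
have [a fa] := isomorphic_scalar Z'ZX Xsc (idm Z' ⊠ f); exists a.
have fa2 : idm (Z ⊗ Z') ⊠ f = a *: idm _.
  rewrite -[LHS]compm1 -(ascVK Z Z' (Z ⊗ X)) compA -tensm1 -asc_nat fa tensmZ tensm1.
  by rewrite compmZ compZm compm1 ascVK.
have fa1 : idm (tunit C) ⊠ f = a *: idm _.
  have -> : idm (tunit C) ⊠ f = (j ⊠ idm _) ∘ (idm (Z ⊗ Z') ⊠ f) ∘ (j' ⊠ idm _).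
    by rewrite -!tensm_comp compm1 jj' comp1m compm1.
  by rewrite fa2 compmZ compm1 compZm tensm_idl jj' tensm1.
by rewrite -[LHS]compm1 -lunVK compA -lun_nat fa1 compmZ compm1 compZm lunVK.
Qed.

Lemma invertible_has_degree Z X :
  invertible Z -> simple_ob X -> exists a, has_degree X (a *: idm Z).
Proof.
move=> Zinv Xs.
have [a Ma] := invertible_tens_scalar (monodromy Z X) (fun h => simple_scalar Cab h Xs) Zinv.
by exists a; rewrite /has_degree tensZm tensm1.
Qed.

Lemma is_iso_monodromy A X : is_iso (monodromy A X).
Proof.
have [b [bb b'b]] := braid_iso A X; have [c [cc c'c]] := braid_iso X A.
by exists (b ∘ c); rewrite /monodromy !compA (compAE cc) (compAE b'b) !compm1.
Qed.

Lemma tunit_tens_neq0 X : ~ is_zero X -> idm (tunit C ⊗ X) != 0.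
Proof.
move=> Xn0; apply/eqP=> e; apply: Xn0.
by rewrite /is_zero -lunVK -[lun X]compm1 e compm0 comp0m.
Qed.

(** The unit is invertible, so its monodromy with [X] is a scalar [a], nonzero because monodromy is
    invertible. Multiplicativity along the unit tensored with itself gives [a * a = a]. *)
Lemma has_degree_tunitl X : simple_ob X -> has_degree X (idm (tunit C)).
Proof.
move=> Xs; have inv1 : invertible (tunit C).
  by exists (tunit C), (lun _), (lun' _); rewrite lunK lunVK.
have [a Ma] := invertible_has_degree inv1 Xs.
have Xn0 := tunit_tens_neq0 (proj1 Xs).
have an0 : a != 0.
  apply: contraNneq Xn0 => a0; have [M' [M'M _]] := is_iso_monodromy (tunit C) X.
  by rewrite -M'M Ma a0 scale0r tens0m compm0.
have : (a * a) *: idm (tunit C ⊗ X) = a *: idm _.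
  have := monodromy_nat (lun (tunit C)) (idm X).
  rewrite (has_degree_tensl Ma Ma) Ma !tensZm tensmZ !tensZm !tensm1 compZm !compmZ comp1m compm1.
  move/(congr1 (fun h => h ∘ (lun' (tunit C) ⊠ idm X))).
  by rewrite !compZm tensm_idl lunVK tensm1 scalerA.
move/eqP; rewrite -subr_eq0 -scalerBl scaler_eq0 (negPf Xn0) orbF -{3}[a]mulr1 -mulrBr.
rewrite mulf_eq0 (negPf an0) subr_eq0 => /eqP a1.
by move: Ma; rewrite a1 scale1r.
Qed.

(** Additivity extends the previous lemma from simple objects to [A]; conjugating by the braiding
    then exchanges the two arguments of the monodromy. *)
Lemma has_degree_tunitr A : has_degree (tunit C) (idm A).
Proof.
have [n [Xs [Xss dA]]] := proj2 Css A.
have := has_degree_dsum (fun k => has_degree_tunitl (Xss k)) dA.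
rewrite /has_degree /monodromy !tensm1 => e.
have [b [bb b'b]] := braid_iso (tunit C) A.
by rewrite -[LHS]compm1 -b'b compA -(compA _ (braid A _)) e compm1.
Qed.

Lemma scalar_ofK (f : mor (tunit C) (tunit C)) : f = scalar_of f *: idm _.
Proof.
have [a ->] := btc_one_scalar f; congr (_ *: _); rewrite /scalar_of linearZ /=.
have fr : free [tuple idm (tunit C)].
  by rewrite /= seq1_free; apply/eqP; apply: btc_one_neq0.
by rewrite -[X in coord _ _ X]/([tuple idm (tunit C)]`_(@ord0 0)) coord_free // eqxx mulr1.
Qed.

Lemma loop_qdim X : evr X ∘ coev X = qdim X *: idm _.
Proof. by rewrite [LHS]scalar_ofK /qdim /qtrace tensm1 compm1. Qed.

(** The closed [X]-strand splits off [f] as a scalar. Allowing [A] and [B] to differ lets simple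
    objects be cancelled for arbitrary parallel morphisms in [tens_idm_inj]. *)
Lemma loop_tens A B X (f : mor A B) :
  run B ∘ (idm B ⊠ evr X) ∘ asc' B X (dual_ob X) ∘ ((f ⊠ idm X) ⊠ idm (dual_ob X))
    ∘ asc A X (dual_ob X) ∘ (idm A ⊠ coev X) ∘ run' A = qdim X *: f.
Proof.
rewrite (compAE2 (asc'_nat _ _ _)) (compAE (ascK _ _ _)) compm1 tensm1.
rewrite (compAE2 (tensm_swap f (coev X))) (compAE (tensm_idr _ _ _)) loop_qdim.
by rewrite tensmZ tensm1 compmZ !compZm compm1 run_nat -compA runVK compm1.
Qed.

Lemma ptrace_tens A X (g : mor A A) : ptrace (g ⊠ idm X) = qdim X *: g.
Proof. exact: loop_tens. Qed.

(* Up to the isomorphism Hom(X* ⊗ X, 1) ~ End X, evaluation is a basis of the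
   left-hand side when X is simple. *)
Lemma dual_zigzag X (q : mor (dual_ob X ⊗ X) (tunit C)) :
  ev X ∘ (idm (dual_ob X) ⊠ (run X ∘ (idm X ⊠ q) ∘ asc' X (dual_ob X) X
                               ∘ (coev X ⊠ idm X) ∘ lun' X)) = q.
Proof.
set D := dual_ob X; rewrite -!tensm_idr !compA idm_run !compA -run_nat.
rewrite (compAE (asc_nat _ _ _)) tensm1 !compA (compAE (tensm_swap _ _)) !compA.
rewrite run_tunit lun_nat.
rewrite lun_tens !compA -tensm1 (compAE (asc_nat _ _ _)) !compA.
rewrite -(compA _ (asc (D ⊗ X) D X)) -(compA _ _ (idm D ⊠ asc' X D X)) pentagon !compA.
rewrite (compAE (asc_nat _ _ _)) !compA (compAE (triangle _ _)).
rewrite -!(compA q) !(tensm_idl X).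
by rewrite dual_snaker tensm1 compm1.
Qed.

Lemma hom_dual_scalar X (q : mor (dual_ob X ⊗ X) (tunit C)) :
  simple_ob X -> exists a, q = a *: ev X.
Proof.
move=> Xs; have [a e] := simple_scalar Cab
  (run X ∘ (idm X ⊠ q) ∘ asc' X (dual_ob X) X ∘ (coev X ⊠ idm X) ∘ lun' X) Xs.
by exists a; rewrite -[q]dual_zigzag e tensmZ compmZ tensm1 compm1.
Qed.

Lemma coev_neq0 X : ~ is_zero X -> coev X <> 0.
Proof.
move=> Xn0 c0; apply: Xn0; rewrite /is_zero -dual_snakel c0 tens0m.
by rewrite compm0 comp0m.
Qed.

(** Semisimplicity gives a morphism from [X ⊗ D] to the unit that does not kill [coev X]. By
    [hom_dual_scalar], up to braiding and a twist scalar, it is a multiple of [evr X], so its value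
    on [coev X] is a multiple of the dimension. *)
Lemma qdim_neq0 X : simple_ob X -> qdim X != 0.
Proof.
move=> Xs; set D := dual_ob X.
have [U [V [i [p [Us Vs pcn0]]]]] := nonzero_simple_component Css (coev_neq0 (proj1 Xs)).
have [r [rpc _]] := schur_iso Cab Us Vs pcn0.
(* Here [r] inverts a nonzero simple component of [coev X], so [i ∘ r ∘ p] detects [coev X]. *)
have qcn0 : i ∘ r ∘ p ∘ coev X <> 0.
  move=> /(congr1 (fun h => h ∘ i)); rewrite -!compA (compA p) rpc compm1 comp0m => i0.
  by apply: pcn0; rewrite i0 compm0.
have [b [bb b'b]] := braid_iso X D.
have [a qE] := hom_dual_scalar (i ∘ r ∘ p ∘ b) Xs.
have [t tE] := simple_scalar Cab (twist X) Xs.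
have tn0 : t != 0.
  apply/eqP=> t0; have [u [ut _]] := twist_iso X.
  by apply: (proj1 Xs); rewrite /is_zero -ut tE t0 scale0r compm0.
apply/eqP=> d0; apply: qcn0.
have -> : i ∘ r ∘ p = (a * t^-1) *: evr X.
  rewrite /evr tE tensZm tensm1 compmZ compm1 scalerA mulfVK // -compZm -qE.
  by rewrite -(compA _ b) bb compm1.
by rewrite compZm loop_qdim d0 scale0r scaler0.
Qed.

Lemma tens_idm_inj A B X (f g : mor A B) :
  simple_ob X -> f ⊠ idm X = g ⊠ idm X -> f = g.
Proof.
move=> Xs e; by apply: (scalerI (qdim_neq0 Xs)); rewrite -!loop_tens e.
Qed.

Lemma has_degree_del0 A X (g : mor A A) : simple_ob X -> has_degree X g -> del0 A X = g.
Proof.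
move=> Xs gX; rewrite /del0 -/(monodromy A X) gX ptrace_tens scalerA mulVf ?scale1r //.
exact: qdim_neq0.
Qed.

Lemma has_degree_unit_fixed A X g (eta : mor (tunit C) A) :
  simple_ob X -> has_degree X g -> g ∘ eta = eta.
Proof.
move=> Xs gX; apply: (tens_idm_inj Xs); rewrite -tensm_idl -gX monodromy_nat.
by rewrite (has_degree_tunitl Xs) tensm1 compm1.
Qed.

(** Naturality of the monodromy along [m] compares the degree [g] of [X] on [A] with [g ⊠ g] on
    [A ⊗ A]; cancelling the simple object [X] gives multiplicativity. *)
Lemma has_degree_monoid_aut A X g (m : mor (A ⊗ A) A) (eta : mor (tunit C) A) :
  simple_ob X -> has_degree X g -> monoid_aut m eta g.
Proof.
move=> Xs gX; apply/andP; split; apply/eqP; last exact: has_degree_unit_fixed gX.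
apply: (tens_idm_inj Xs); rewrite -tensm_idl -gX monodromy_nat.
by rewrite (has_degree_tensl gX gX) tensm_idl.
Qed.

(** Duality data on an arbitrary [Y], since [S] is only known to contain an object isomorphic to
    [dual_ob X]. *)
Record dual_pair X Y (e : mor (Y ⊗ X) (tunit C)) (c : mor (tunit C) (X ⊗ Y)) : Prop := {
  snakel : run X ∘ (idm X ⊠ e) ∘ asc' X Y X ∘ (c ⊠ idm X) ∘ lun' X = idm X;
  snaker : lun Y ∘ (e ⊠ idm Y) ∘ asc Y X Y ∘ (idm Y ⊠ c) ∘ run' Y = idm Y
}.

Lemma dual_pair_iso X Y (t : mor Y (dual_ob X)) (t' : mor (dual_ob X) Y) :
  t' ∘ t = idm Y -> t ∘ t' = idm _ ->
  dual_pair (ev X ∘ (t ⊠ idm X)) ((idm X ⊠ t') ∘ coev X).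
Proof.
set D := dual_ob X => t't tt'; split.
  rewrite -(tensm_idl X) !compA (compAE (asc'_nat _ _ _)) !compA.
  rewrite (compAE (tensm_idr _ _ _)) -(compA (ev X)) tensm_idl tt' tensm1 compm1.
  exact: dual_snakel.
rewrite -t't -[t in RHS]comp1m -dual_snaker -/D !compA -lun_nat.
rewrite -!(compA _ _ t) run'_nat !compA.
rewrite (compAE2 (esym (tensm_swap _ _))) -tensm1 (compAE2 (esym (asc_nat _ _ _))).
rewrite (compAE (tensm_idr _ _ _)) (compAE2 (esym (tensm_swap _ _))) -tensm1.
by rewrite t't (compAE2 (asc_nat _ _ _)) (compAE (tensm_idl _ _ _)).
Qed.

Lemma qdim_dual_pair X Y (t : mor Y (dual_ob X)) (t' : mor (dual_ob X) Y) :
  t ∘ t' = idm _ -> twist X = idm X ->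
  (ev X ∘ (t ⊠ idm X)) ∘ braid X Y ∘ ((idm X ⊠ t') ∘ coev X) = qdim X *: idm (tunit C).
Proof.
move=> tt' tw; rewrite -loop_qdim /evr tw tensm1 compm1 !compA.
by rewrite (compAE (braid_nat _ _)) !compA (compAE (tensm_idl _ _ _)) tt' tensm1 compm1.
Qed.

End Braided.

(** * Duality and dimension through the fiber functor on [S] *)

Section FiberFunctor.
Context (F : closedFieldType) (C : btc F) (S : C -> Prop) (gT : finGroupType).
Context (E : rep_equivalence S gT).
Implicit Types X Y Z : C.
Local Notation mu := (re_mu E).
Local Notation "1E" := (re_one E).

Lemma S_unit : S (tunit C). Proof. by case: (re_tensor E). Qed.
Lemma S_tens X Y : S X -> S Y -> S (X ⊗ Y).
Proof. by case: (re_tensor E) => _; apply. Qed.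
#[local] Hint Resolve S_unit S_tens : core.

Lemma re_morK X Y (f : mor X Y) (g : mor Y X) v :
  S X -> S Y -> g ∘ f = idm X -> re_mor E g (re_mor E f v) = v.
Proof. by move=> SX SY gf; rewrite -re_mor_comp // gf re_mor_id. Qed.

Lemma re_mu_assoc' X Y Z (u : E X) (v : E Y) (w : E Z) : S X -> S Y -> S Z ->
  re_mor E (asc' X Y Z) (mu (mu u v) w) = mu u (mu v w).
Proof. by move=> SX SY SZ; rewrite -re_mu_assoc // re_morK ?ascK //; auto. Qed.

Lemma re_mu_lun' X (v : E X) : S X -> re_mor E (lun' X) v = mu 1E v.
Proof. by move=> SX; rewrite -[v in LHS](re_mu_unitl (r := E) v SX) re_morK ?lunK //; auto. Qed.

Lemma re_mu_run' X (v : E X) : S X -> re_mor E (run' X) v = mu v 1E.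
Proof. by move=> SX; rewrite -[v in LHS](re_mu_unitr (r := E) v SX) re_morK ?runK //; auto. Qed.

Lemma re_one_coord (z : E (tunit C)) : exists a, z = a *: 1E.
Proof.
have /vlineP[a ->] : z \in <[1E]>%VS by rewrite -span_seq1 (span_basis (re_one_basis E)) memvf.
by exists a.
Qed.

Lemma re_one_neq0 : 1E != 0.
Proof. by have := basis_free (re_one_basis E); rewrite seq1_free. Qed.

(** Pure tensors span by the uniqueness in [re_univ]: the identity and the projection onto their
    span both extend [mu]. *)
Lemma re_mu_span X Y n (e : n.-tuple (E X)) (u : E (X ⊗ Y)) :
  S X -> S Y -> basis_of fullv e ->
  exists y : 'I_n -> E Y, u = \sum_(j < n) mu e`_j (y j).
Proof.
move=> SX SY eb; pose f := vbasis {:E Y}.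
pose B := allpairs mu e f; pose U := <<B>>%VS.
have muU v w : mu v w \in U.
  rewrite (coord_basis eb (memvf v)) (lin_sum (re_mu_linear_l (r := E) w SX SY)).
  apply: memv_suml => i _; rewrite (linZ (re_mu_linear_l (r := E) w SX SY)) memvZ //.
  rewrite (coord_vbasis (memvf w)) (lin_sum (re_mu_linear_r (r := E) e`_i SX SY)).
  apply: memv_suml => j _; rewrite (linZ (re_mu_linear_r (r := E) e`_i SX SY)) memvZ //.
  by apply/memv_span/allpairs_f; rewrite mem_nth ?size_tuple.
have [h [_ hU]] := re_univ (r := E) SX SY
  (fun w => re_mu_linear_l (r := E) w SX SY) (fun v => re_mu_linear_r (r := E) v SX SY).
have /lfunP/(_ u) : projv U = \1%VF.
  have h1 : h = projv U by apply: hU => v w; apply: projv_id.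
  have h2 : h = \1%VF by apply: hU => v w; rewrite lfunE.
  by rewrite -h1 h2.
rewrite lfunE /= => Uu.
have {Uu} : u \in U by rewrite -Uu memv_proj.
have muL := fun v => re_mu_linear_r (r := E) v SX SY.
rewrite /U => /(@coord_span _ _ _ (in_tuple B)) ->.
apply: (big_ind (fun u' => exists y : 'I_n -> E Y, u' = \sum_(j < n) mu e`_j (y j)))
  => [|_ _ [y1 ->] [y2 ->]|i _].
- by exists (fun _ => 0); rewrite big1 // => j _; rewrite (lin0 (muL _)).
(* The sum is written as a difference so that [linB] applies. *)
- exists (fun j => y1 j - - y2 j); rewrite -big_split; apply: eq_bigr => j _ /=.
  by rewrite (linB (muL _)) -[- y2 j]sub0r (linB (muL _)) (lin0 (muL _)) sub0r opprK.
have /allpairsP[[v w] /= [ve _ ->]] := mem_nth 0 (ltn_ord i).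
have /tnthP[k vk] := ve.
exists (fun j => if j == k then coord (in_tuple B) i u *: w else 0).
rewrite (bigD1 k) //= eqxx big1 => [|j /negPf->]; last by rewrite (lin0 (muL _)).
by rewrite addr0 vk (tnth_nth 0) (linZ (muL _)).
Qed.

Section DualPair.
Context (X Y : C) (SX : S X) (SY : S Y).
Context (ev' : mor (Y ⊗ X) (tunit C)) (co' : mor (tunit C) (X ⊗ Y)).
Hypothesis dXY : dual_pair ev' co'.
Context (n : nat) (e : n.-tuple (E X)) (eb : basis_of fullv e).

Definition pairing (w : E Y) (v : E X) : F :=
  coord [tuple 1E] ord0 (re_mor E ev' (mu w v)).

Lemma pairingE w v : re_mor E ev' (mu w v) = pairing w v *: 1E.
Proof.
rewrite /pairing; have [a ->] := re_one_coord (re_mor E ev' (mu w v)).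
rewrite linearZ /= -[X in coord _ _ X]/([tuple 1E]`_(@ord0 0)) coord_free ?eqxx ?mulr1 //.
exact: basis_free (re_one_basis E).
Qed.

(** The first snake identity expands every vector in [e] with coefficients its pairings with the
    [y j], so these form the basis dual to [e]. *)
Lemma coev_expansion : exists y : 'I_n -> E Y,
  re_mor E co' 1E = \sum_(j < n) mu e`_j (y j) /\
  forall j k : 'I_n, pairing (y j) e`_k = (j == k)%:R.
Proof.
have [y uy] := re_mu_span (re_mor E co' 1E) SX SY eb; exists y; split=> // j k.
have exp v : v = \sum_(j < n) pairing (y j) v *: e`_j.
  rewrite -[LHS](re_mor_id (r := E) v SX) -(snakel dXY) !re_mor_comp //; auto.
  rewrite re_mu_lun' // re_mu_nat //; auto.
  rewrite re_mor_id // uy (lin_sum (re_mu_linear_l (r := E) v (S_tens SX SY) SX)) !linear_sum.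
  apply: eq_bigr => i _ /=; rewrite re_mu_assoc' // re_mu_nat //; auto.
  rewrite re_mor_id // pairingE (linZ (re_mu_linear_r (r := E) _ SX S_unit)) linearZ /=.
  by rewrite re_mu_unitr.
have := congr1 (coord e j) (exp e`_k); rewrite coord_free ?(basis_free eb) // linear_sum.
rewrite (bigD1 j) //= linearZ /= coord_free ?(basis_free eb) // eqxx mulr1 big1 => [|i ij].
  by rewrite addr0 eq_sym => <-.
by rewrite linearZ /= coord_free ?(basis_free eb) // (negPf ij) mulr0.
Qed.

(** The braiding becomes the flip of vector spaces, and each dual basis pair contributes 1. *)
Lemma dual_pair_trace :
  re_mor E (ev' ∘ braid X Y ∘ co') 1E = n%:R *: 1E.
Proof.
have [y [uy yP]] := coev_expansion.
rewrite !re_mor_comp //; auto; rewrite uy !linear_sum /= -[n in RHS]card_ord -sum1_card.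
rewrite natr_sum scaler_suml; apply: eq_bigr => j _.
by rewrite re_symmetric // pairingE yP eqxx.
Qed.

End DualPair.

(** One composite is the trace, equal to 1. For the other, every vector is the basis vector tensored
    with some [w], and the second snake identity recovers [w]. *)
Lemma dual_pair_iso1 X Y (ev' : mor (Y ⊗ X) (tunit C)) (co' : mor (tunit C) (X ⊗ Y))
    (e : 1.-tuple (E X)) :
  S X -> S Y -> dual_pair ev' co' -> basis_of fullv e ->
  isomorphic (X ⊗ Y) (tunit C).
Proof.
move=> SX SY dXY eb; exists (ev' ∘ braid X Y), co'.
have SYX := S_tens SY SX; have SXY := S_tens SX SY.
have [y [uy yP]] := coev_expansion SX SY dXY eb; rewrite big_ord1 in uy.
split; last first.
  apply: (re_faithful (r := E) S_unit S_unit); apply/lfunP=> z.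
  have [a ->] := re_one_coord z; rewrite !linearZ /=.
  by rewrite (dual_pair_trace SX SY dXY eb) re_mor_id // scale1r.
apply: (re_faithful (r := E) SXY SXY); apply/lfunP=> u.
rewrite re_mor_id //; have [w ->] := re_mu_span u SX SY eb; rewrite big_ord1.
rewrite !re_mor_comp //; rewrite re_symmetric // (pairingE _ (w ord0)) linearZ /= uy.
rewrite -(linZ (re_mu_linear_r (r := E) _ SX SY)); congr (mu _ _).
rewrite -[RHS](re_mor_id (r := E) (w ord0) SY) -(snaker dXY) !re_mor_comp //; auto.
rewrite re_mu_run' // re_mu_nat //; auto.
rewrite re_mor_id // uy re_mu_assoc // re_mu_nat //; auto.
rewrite pairingE re_mor_id // (linZ (re_mu_linear_l (r := E) _ S_unit SY)) linearZ /=.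
by rewrite re_mu_unitl.
Qed.

End FiberFunctor.

(** * The regular monoid and its degrees *)

Section RegularMonoid.
Context (F : closedFieldType) (charF : [pchar F] =i pred0).
Context (C : btc F) (S : C -> Prop).
Context (S_even : symmetric_even S) (S_one_dim : simples_one_dim S).
Implicit Types X Y Z : C.

Lemma qdim_dim gT (E : rep_equivalence S gT) X n (e : n.-tuple (E X)) :
  S X -> basis_of fullv e -> qdim X = n%:R.
Proof.
move=> SX eb; have [Y [SY [t [t' [t't tt']]]]] := se_dual S_even SX.
have S1 := S_unit E.
have := dual_pair_trace SX SY (dual_pair_iso t't tt') eb.
rewrite (qdim_dual_pair tt' (se_twist S_even SX)) (linZ (@re_mor_linear _ _ _ _ E _ _ S1 S1)).
rewrite scale_lfunE re_mor_id // => /eqP.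
by rewrite -subr_eq0 -scalerBl scaler_eq0 (negPf (re_one_neq0 E)) orbF subr_eq0 => /eqP.
Qed.

Lemma dim1_invertible gT (E : rep_equivalence S gT) X (e : 1.-tuple (E X)) :
  S X -> basis_of fullv e -> invertible X.
Proof.
move=> SX eb; have [Y [SY [t [t' [t't tt']]]]] := se_dual S_even SX; exists Y.
exact: dual_pair_iso1 SX SY (dual_pair_iso t't tt') eb.
Qed.

Lemma one_dim gT (E : rep_equivalence S gT) X :
  S X -> qdim X = 1 ->
  invertible X /\ exists e0 : E X, forall v, exists a, v = a *: e0.
Proof.
move=> SX d1; have := vbasisP {:E X}; move: (vbasis _); move: (\dim _) => n e eb.
have dn := qdim_dim SX eb.
have n1 : n = 1%N.
  (* Characteristic zero makes the natural number [n] recoverable from its image in the field. *)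
  case: n dn {e eb} => [|[|n]] //.
    by rewrite d1 => /eqP; rewrite oner_eq0.
  rewrite d1 -[n.+2]addn1 natrD -[X in X = _]add0r => /addIr /esym /eqP.
  by move/pcharf0P: charF => ->.
subst n; split; first exact: dim1_invertible SX eb.
exists e`_0 => v; exists (coord e ord0 v).
by rewrite [LHS](coord_basis eb (memvf v)) big_ord1.
Qed.

(** Multiplicity freeness is recorded in the last clause: each inclusion [i k] is an eigenvector of
    composition with any endomorphism of [Gamma]. *)
Lemma regular_decomposition (Gamma : C) (m : mor (Gamma ⊗ Gamma) Gamma)
    (eta : mor (tunit C) Gamma) :
  regular_monoid S m eta ->
  exists n (Xs : 'I_n -> C) (i : forall k, mor (Xs k) Gamma) (p : forall k, mor Gamma (Xs k)),
    [/\ forall k, invertible (Xs k), \sum_(k < n) i k ∘ p k = idm Gamma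
      & forall (g : mor Gamma Gamma) k, exists a, g ∘ i k = a *: i k].
Proof.
move=> [SG [gT [E [phi [phi_bij phi_act _ _]]]]].
have [_ /(_ (exist S Gamma SG)) [n [Xs [Xss [i [p [pi _ ip]]]]]]] := se_semisimple S_even.
exists n, (fun k => sval (Xs k)), i, p; split=> [k||g k] //.
  by case: (one_dim E (svalP (Xs k)) (S_one_dim (Xss k))).
have SX := svalP (Xs k); have [_ [e0 e0P]] := one_dim E SX (S_one_dim (Xss k)).
set X := sval (Xs k) in SX e0 e0P *.
have reL := @re_mor_linear _ _ _ _ E _ _ SX SG.
(* A morphism from X to Gamma is determined by the value of the function
   [phi (re_mor E h e0)] at the unit, by equivariance and as e0 spans [E X]. *)
have hom0 (h : mor X Gamma) : phi (re_mor E h e0) 1%g = 0 -> h = 0.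
  move=> h1; apply: (re_faithful (r := E) SX SG); rewrite (lin0 reL).
  apply/lfunP=> v; rewrite zero_lfunE; apply: (bij_inj phi_bij); apply/ffunP=> x.
  rewrite linear0 ffunE -[x]mulg1 -{1}[x]invgK -phi_act -re_mor_equiv //.
  by have [a ->] := e0P (rep_act (E X) x^-1%g v); rewrite !linearZ ffunE h1 scaler0.
(* The eigenvalue is the quotient of the values at the unit of the group, unless [i k] vanishes. *)
have [c0|cn0] := eqVneq (phi (re_mor E (i k) e0) 1%g) 0.
  by exists 0; rewrite (hom0 _ c0) compm0 scaler0.
set c := phi _ _ in cn0.
exists (phi (re_mor E (g ∘ (i k : mor X Gamma)) e0) 1%g / c).
apply/eqP; rewrite -subr_eq0; apply/eqP/hom0; rewrite (linB reL) (linZ reL).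
by rewrite add_lfunE opp_lfunE scale_lfunE linearB linearZ !ffunE -/c [_ *: c]mulfVK // subrr.
Qed.

Context (Gamma : C) (m : mor (Gamma ⊗ Gamma) Gamma) (eta : mor (tunit C) Gamma).
Context (reg : regular_monoid S m eta).

Lemma regular_end_comm (g h : mor Gamma Gamma) : g ∘ h = h ∘ g.
Proof.
have [n [Xs [i [p [_ ip gi]]]]] := regular_decomposition reg.
rewrite -[LHS]compm1 -[RHS]compm1 -ip !comp_sumr; apply: eq_bigr => k _.
have [a ga] := gi g k; have [b hb] := gi h k.
by rewrite !compA (compAE hb) (compAE ga) !compmZ ga hb !scalerA mulrC.
Qed.

Lemma simple_has_degree X : simple_ob X -> exists g : mor Gamma Gamma, has_degree X g.
Proof.
move=> Xs; have [n [Zs [i [p [Zinv ip _]]]]] := regular_decomposition reg.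
have /fin_all_exists[a Ma] k := invertible_has_degree (Zinv k) Xs.
exists (\sum_(k < n) a k *: (i k ∘ p k)).
rewrite /has_degree -[LHS]compm1 -tensm1 -ip !tens_suml comp_sumr.
apply: eq_bigr => k _; rewrite -tensm_idl compA monodromy_nat Ma !tensZm tensm1.
by rewrite compmZ compm1 compZm tensm_idl.
Qed.

Lemma has_degree_simple_del0 X : simple_ob X -> has_degree X (del0 Gamma X).
Proof. by move=> Xs; have [g gX] := simple_has_degree Xs; rewrite (has_degree_del0 Xs gX). Qed.

(** This trades a condition on simple summands for one on the monodromy, to which the hexagon lemmas
    apply. *)
Lemma homogeneousP X : homogeneous Gamma X <-> exists g : mor Gamma Gamma, has_degree X g.
Proof.
split=> [hX | [g gX] Y Z Ys YX Zs ZX]; last first.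
  by rewrite !(has_degree_del0 _ (has_degree_summand _ gX)).
have [n [Xs [Xss dX]]] := proj2 (btc_semisimple C) X.
have sX k := direct_sum_summand k dX.
case: n Xs Xss dX sX => [|n] Xs Xss dX sX.
  (* The empty sum is a zero object, which has every degree. *)
  by exists (idm _); apply: has_degree_dsum dX => -[].
exists (del0 Gamma (Xs ord0)); apply: has_degree_dsum dX => k.
by rewrite (hX (Xs ord0) (Xs k)) //; apply: has_degree_simple_del0.
Qed.

Lemma simple_homogeneous X : simple_ob X -> homogeneous Gamma X.
Proof. by move=> Xs; apply/homogeneousP; apply: simple_has_degree. Qed.

(** Homogeneity is a premise inside the existential, so that choice yields a degree map on all
    objects; zero objects get the neutral element. *)
Lemma degree_exists X : exists a : MonAut reg,
  homogeneous Gamma X -> forall Y, simple_ob Y -> is_summand Y X -> aut_val a = del0 Gamma Y.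
Proof.
have [X0|Xn0] := boolp.EM (is_zero X).
  by exists (aut_one reg) => _ Y [Yn0 _] /(is_zero_summand X0).
have [Y Ys YX] := nonzero_simple_summand (btc_semisimple C) Xn0.
exists (MkMonAut reg (has_degree_monoid_aut m eta Ys (has_degree_simple_del0 Ys))).
by move=> hX Z Zs ZX; apply: hX.
Qed.

End RegularMonoid.

(** * The grading of the category *)

Theorem proposition3p28 (F : closedFieldType) (charF : [pchar F] =i pred0)
    (C : btc F) (S : C -> Prop)
    (S_even : symmetric_even S)
    (S_finite : finite_cat (full_subcat S))
    (S_one_dim : simples_one_dim S)
    (Gamma : C) (m : mor (Gamma ⊗ Gamma) Gamma) (eta : mor (tunit C) Gamma)
    (reg : regular_monoid S m eta) :
  (forall X : C, simple_ob X -> monoid_aut m eta (del0 Gamma X)) /\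
  exists deg : C -> MonAut reg,
    (forall X Y : C, homogeneous Gamma X -> simple_ob Y -> is_summand Y X ->
       aut_val (deg X) = del0 Gamma Y) /\
    crossed_category (homogeneous Gamma) deg (fun _ => id_tensor_functor C).
Proof.
have Css := btc_semisimple C.
have simple_deg := has_degree_simple_del0 charF S_even S_one_dim reg.
have homP := homogeneousP charF S_even S_one_dim reg.
split=> [X Xs|]; first exact: has_degree_monoid_aut (simple_deg X Xs).
have [deg degP] := boolp.choice (degree_exists charF S_even S_one_dim reg).
exists deg; split=> [X Y hX Ys YX|]; first exact: degP.
have degE X g : ~ is_zero X -> has_degree X g -> aut_val (deg X) = g.
  move=> Xn0 gX; have [Y Ys YX] := nonzero_simple_summand Css Xn0.
  rewrite (degP X _ Y Ys YX); last by apply/homP; exists g.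
  exact: has_degree_del0 Ys (has_degree_summand YX gX).
have homT X Y g h : @has_degree F C Gamma X g -> has_degree Y h -> has_degree (X ⊗ Y) (g ∘ h).
  exact: has_degree_tensr.
split.
- split=> [|X Y /homP[g gX] /homP[h hY]]; apply/homP.
    by exists (idm Gamma); apply: has_degree_tunitr.
  by exists (g ∘ h); apply: homT.
- move=> X Y hX hY Xn0 XY; apply: val_inj => /=.
  have [U Us UX] := nonzero_simple_summand Css Xn0.
  rewrite (degP X hX U Us UX) (degP Y hY U Us) //.
  apply: is_summand_trans UX _; exact: isomorphic_summand.
- move=> X Y /homP[g gX] /homP[h hY] Xn0 Yn0; apply: val_inj => /=.
  rewrite (degE X g) // (degE Y h) //; apply: degE (homT _ _ _ _ gX hY).
  (* If [X ⊗ Y] were zero, so would be [X ⊗ U] for a simple summand [U] of [Y], and cancelling [U]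
     would make [X] zero. *)
  move=> XY0; have [U Us [i [p pi]]] := nonzero_simple_summand Css Yn0.
  apply: Xn0; apply: (tens_idm_inj Us); rewrite tensm1 tens0m.
  have := congr1 (fun f => (idm X ⊠ p) ∘ f ∘ (idm X ⊠ i)) XY0.
  by rewrite /= compm1 compm0 comp0m tensm_idr pi tensm1.
- move=> X; have [n [Xs [Xss dX]]] := proj2 Css X; exists n, Xs; split=> // k.
  exact: (simple_homogeneous charF S_even S_one_dim reg (Xss k)).
- by [].
- move=> g X _ _.
  (* The group is abelian, so conjugation fixes degrees and the identity functors respect them. *)
  have gC : (g * deg X)%g = (deg X * g)%g.
    by apply: val_inj; apply: (regular_end_comm charF S_even S_one_dim reg).
  by rewrite gC mulgK.
- by exists (fun _ => erefl) => X Y f; apply: eqm_refl_comp.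
- by move=> g h; exists (fun _ => erefl) => X Y f; apply: eqm_refl_comp.
Qed.
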